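(* There is a surjective bounded linear operator $T:\ell_\infty/c_0\rightarrow\ell_\infty/c_0$ which is liftable but is nowhere a nonzero matrix operator; that is, whenever $A,B\subseteq\mathbb{N}$ are infinite and $T_{B,A}$ is a matrix operator, then $T_{B,A}=0$.
   Context: Operators are bounded and linear; $[f]$ denotes the class of $f$ modulo null functions. $T:\ell_\infty/c_0\rightarrow\ell_\infty/c_0$ is liftable if there is a bounded linear $R:\ell_\infty\rightarrow\ell_\infty$ with $R[c_0]\subseteq c_0$ such that $T([f])=[R(f)]$ for all $f\in\ell_\infty$. For infinite $A,B\subseteq\mathbb{N}$: $I_A([g])=[g\cup 0_{\mathbb{N}\setminus A}]$ for $g\in\ell_\infty(A)$, $P_B([f])=[f|B]$ for $f\in\ell_\infty$, and $T_{B,A}=P_B\circ T\circ I_A:\ell_\infty(A)/c_0(A)\to\ell_\infty(B)/c_0(B)$. The operator $T_{B,A}$ is a matrix operator if there are $A'\subseteq A$ cofinite in $A$, $B'\subseteq B$ cofinite in $B$, and a real matrix $(b_{ij})_{i\in B',j\in A'}$ defining a bounded operator $c_0(A')\to c_0(B')$ such that $T_{B,A}([f])=[(\sum_{j\in A'}b_{ij}f(j))_{i\in B'}]$ for all $f\in\ell_\infty(A')$ (identifying $\ell_\infty(A')/c_0(A')$ with $\ell_\infty(A)/c_0(A)$, and similarly for $B$). *)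

(* Defs.v *)
From HB Require Import structures.
From mathcomp Require Import all_boot all_order all_algebra.
From mathcomp Require Import generic_quotient ring_quotient.
From mathcomp Require Import all_classical all_reals all_analysis.

Set Implicit Arguments.
Unset Strict Implicit.
Unset Printing Implicit Defensive.

Import Order.TTheory GRing.Theory Num.Theory.
Import numFieldNormedType.Exports.

Local Open Scope classical_set_scope.
Local Open Scope ring_scope.

Section bounded_functions.
Context (R : realType) (I : Type).

Definition linf_pred : {pred I -> R} := fun f => `[< bounded_fun f >].

Lemma linf_predP (f : I -> R) :
  reflect (exists M, forall i, `|f i| <= M) (f \in linf_pred).
Proof.
rewrite unfold_in; apply: (iffP (asboolP _)) => [[M [_ fM]]|[M fM]].
  by exists (M + 1) => i; apply: fM => //; rewrite ltrDl.
by exists M; split; [exact: num_real|move=> x Mx i _; exact: le_trans (ltW Mx)].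
Qed.

Lemma linf_submod_closed : submod_closed linf_pred.
Proof.
split=> [|a f g /linf_predP[M fM] /linf_predP[N gN]]; apply/linf_predP.
  by exists 0 => i; rewrite normr0.
exists (`|a| * M + N) => i; apply: (le_trans (ler_normD _ _)).
by rewrite lerD// normrM ler_wpM2l.
Qed.

HB.instance Definition _ :=
  GRing.isSubmodClosed.Build _ _ linf_pred linf_submod_closed.

Record linf : Type := Linf {
  linf_val :> I -> R;
  linf_valP : linf_val \in linf_pred }.

HB.instance Definition _ := [isSub for linf_val].
HB.instance Definition _ := [Choice of linf by <:].
HB.instance Definition _ := [SubChoice_isSubLmodule of linf by <:].

(* If I is empty then so is the range, and [sup set0 = 0]. *)
Definition linf_norm (f : linf) : R := sup (range (fun i => `|f i|)).

Lemma linf_norm_ub (f : linf) i : `|f i| <= linf_norm f.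
Proof.
have [M fM] := linf_predP _ (linf_valP f).
by apply: ub_le_sup; [exists M => _ [j _ <-]|exists i].
Qed.

Lemma linf_norm_le (f : linf) (M : R) :
  0 <= M -> (forall i, `|f i| <= M) -> linf_norm f <= M.
Proof.
move=> M0 fM; rewrite /linf_norm.
have [->|/set0P ne0] := eqVneq (range (fun i => `|f i|)) set0.
  by rewrite sup0.
by apply: ge_sup => // _ [j _ <-].
Qed.

Lemma linf_norm_ge0 (f : linf) : 0 <= linf_norm f.
Proof.
rewrite /linf_norm.
have [->|/set0P[_ [i _ _]]] := eqVneq (range (fun i => `|f i|)) set0.
  by rewrite sup0.
exact: le_trans (linf_norm_ub f i).
Qed.

Lemma linf_ler_normD (f g : linf) :
  linf_norm (f + g) <= linf_norm f + linf_norm g.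
Proof.
apply: linf_norm_le => [|i]; first by rewrite addr_ge0 ?linf_norm_ge0.
by rewrite (le_trans (ler_normD _ _))// lerD ?linf_norm_ub.
Qed.

Lemma linf_normrZ (a : R) (f : linf) : linf_norm (a *: f) = `|a| * linf_norm f.
Proof.
have le1 b g : linf_norm (b *: g) <= `|b| * linf_norm g.
  apply: linf_norm_le => [|i]; first by rewrite mulr_ge0 ?linf_norm_ge0.
  by rewrite [leLHS]normrM ler_wpM2l ?linf_norm_ub.
apply/le_anti; rewrite le1/=.
have [->|a0] := eqVneq a 0; first by rewrite normr0 mul0r linf_norm_ge0.
rewrite -{1}[f]scale1r -(mulVf a0) -scalerA.
by rewrite -ler_pdivlMl ?normr_gt0// -normfV le1.
Qed.

Lemma linf_normr0_eq0 (f : linf) : linf_norm f = 0 -> f = 0.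
Proof.
move=> f0; apply/val_inj/funext => i /=; apply/normr0_eq0/le_anti.
by rewrite normr_ge0 -f0 linf_norm_ub.
Qed.

HB.instance Definition _ := Lmodule_isNormed.Build R linf
  linf_ler_normD linf_normrZ linf_normr0_eq0.

(* Functions vanishing at infinity on the discrete space I; on nat, and on
   subsets of nat, these are the null sequences, cf. [c0_natP]. *)
Definition c0 : {pred linf} :=
  fun f => `[< forall e : R, 0 < e -> finite_set [set i | e <= `|f i|] >].

Lemma c0P (f : linf) :
  reflect (forall e : R, 0 < e -> finite_set [set i | e <= `|f i|]) (f \in c0).
Proof. by rewrite unfold_in; exact: asboolP. Qed.

Lemma c0_submod_closed : submod_closed c0.
Proof.
split=> [|a f g /c0P fc /c0P gc]; apply/c0P => e e0.
  rewrite (_ : mkset _ = set0); first exact: finite_set0.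
  by apply/seteqP; split => // i /=; rewrite normr0 leNgt e0.
have d0 : 0 < e / 2 / (`|a| + 1) by rewrite !divr_gt0// ltr_wpDl.
have e2 : 0 < e / 2 by rewrite divr_gt0.
apply: sub_finite_set (_ : _ `<=`
  [set i | e / 2 / (`|a| + 1) <= `|f i|] `|` [set i | e / 2 <= `|g i|]) _.
- move=> i /= ei; apply/orP; rewrite -[X in X || _]negbK -implybE -ltNge.
  apply/implyP => fi; rewrite leNgt; apply/negP => gi.
  move: ei; apply/negP; rewrite -ltNge (le_lt_trans (ler_normD _ _))//.
  rewrite (splitr e) ltrD// normrM.
  rewrite ltr_pdivlMr ?ltr_wpDl// in fi.
  apply: le_lt_trans fi; rewrite mulrC ler_wpM2l// lerDl//.
- by rewrite finite_setU; split; [exact: fc|exact: gc].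
Qed.

HB.instance Definition _ := GRing.isSubmodClosed.Build _ _ c0 c0_submod_closed.

Definition linf_c0 : Type := Quotient.quot c0.

HB.instance Definition _ := GRing.Zmodule.on linf_c0.
HB.instance Definition _ := EqQuotient.on linf_c0.

Definition cl (f : linf) : linf_c0 := (\pi_linf_c0 f)%qT.

Lemma cl_surj (x : linf_c0) : exists f, cl f = x.
Proof. by exists (repr x); exact: reprK. Qed.

Lemma cl_eq (f g : linf) : cl f = cl g <-> f - g \in c0.
Proof. by rewrite Quotient.idealrBE; split => /eqP. Qed.

Lemma clD (f g : linf) : cl (f + g) = cl f + cl g.
Proof. exact: (@Quotient.pi_add _ c0). Qed.

Lemma cl0 : cl 0 = 0.
Proof. by apply: (addIr (cl 0)); rewrite -clD !add0r. Qed.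

Definition linf_c0_scale (a : R) (x : linf_c0) : linf_c0 := cl (a *: repr x).

Lemma cl_scale (a : R) (f : linf) : linf_c0_scale a (cl f) = cl (a *: f).
Proof.
by apply/cl_eq; rewrite -scalerBr rpredZ//; apply/cl_eq; exact: reprK.
Qed.

Fact linf_c0_scalerA a b x :
  linf_c0_scale a (linf_c0_scale b x) = linf_c0_scale (a * b) x.
Proof. by have [f <-] := cl_surj x; rewrite !cl_scale scalerA. Qed.

Fact linf_c0_scale1r : left_id 1 linf_c0_scale.
Proof. by move=> x; have [f <-] := cl_surj x; rewrite cl_scale scale1r. Qed.

Fact linf_c0_scalerDr : right_distributive linf_c0_scale +%R.
Proof.
move=> a x y; have [f <-] := cl_surj x; have [g <-] := cl_surj y.
by rewrite -clD !cl_scale -clD scalerDr.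
Qed.

Fact linf_c0_scalerDl x : {morph linf_c0_scale^~ x : a b / a + b}.
Proof.
by move=> a b; have [f <-] := cl_surj x; rewrite !cl_scale -clD scalerDl.
Qed.

HB.instance Definition _ := GRing.Zmodule_isLmodule.Build R linf_c0
  linf_c0_scalerA linf_c0_scale1r linf_c0_scalerDr linf_c0_scalerDl.

Lemma cl_is_linear : linear cl.
Proof. by move=> a f g; rewrite clD -cl_scale. Qed.

HB.instance Definition _ := GRing.isLinear.Build R linf linf_c0 _ cl cl_is_linear.

Definition linf_c0_norm (x : linf_c0) : R :=
  inf [set `|f| | f in [set f : linf | cl f = x]].

Lemma linf_c0_norm_le (f : linf) : linf_c0_norm (cl f) <= `|f|.
Proof. by apply: ge_inf; [exists 0 => _ [g _ <-]|exists f]. Qed.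

Lemma linf_c0_norm_lt (x : linf_c0) (M : R) :
  linf_c0_norm x < M -> exists2 f, cl f = x & `|f| < M.
Proof.
move=> xM; have [f fx] := cl_surj x.
have hi : has_inf [set `|f| | f in [set f : linf | cl f = x]].
  by split; [exists `|f|, f|exists 0 => _ [g _ <-]].
have d0 : 0 < M - linf_c0_norm x by rewrite subr_gt0.
have [_ [g gx <-] gM] := inf_adherent d0 hi.
by exists g => //; rewrite -/(linf_c0_norm x) subrKC in gM.
Qed.

Lemma linf_c0_norm_ge0 (x : linf_c0) : 0 <= linf_c0_norm x.
Proof.
have [f fx] := cl_surj x.
by apply: lb_le_inf => [|_ [g _ <-]//]; exists `|f|, f.
Qed.

Lemma linf_c0_ler_normD x y :
  linf_c0_norm (x + y) <= linf_c0_norm x + linf_c0_norm y.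
Proof.
apply/ler_addgt0Pr => e e0; have e2 : 0 < e / 2 by rewrite divr_gt0.
have [f <- fe] : exists2 f, cl f = x & `|f| < linf_c0_norm x + e / 2.
  by apply: linf_c0_norm_lt; rewrite ltrDl.
have [g <- ge] : exists2 g, cl g = y & `|g| < linf_c0_norm y + e / 2.
  by apply: linf_c0_norm_lt; rewrite ltrDl.
rewrite -clD (le_trans (linf_c0_norm_le _))// (le_trans (ler_normD _ _))//.
by rewrite [in leRHS](splitr e) addrACA ltW// ltrD.
Qed.

Lemma linf_c0_normrZ (a : R) x :
  linf_c0_norm (a *: x) = `|a| * linf_c0_norm x.
Proof.
have le1 b y : linf_c0_norm (b *: y) <= `|b| * linf_c0_norm y.
  apply/ler_addgt0Pr => e e0.
  have d0 : 0 < e / (`|b| + 1) by rewrite divr_gt0// ltr_wpDl.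
  have [f <- fe] :
      exists2 f, cl f = y & `|f| < linf_c0_norm y + e / (`|b| + 1).
    by apply: linf_c0_norm_lt; rewrite ltrDl.
  rewrite -linearZ/= (le_trans (linf_c0_norm_le _))// normrZ.
  rewrite (le_trans (ler_wpM2l _ (ltW fe)))// mulrDr lerD2l.
  rewrite mulrCA ger_pMr// ler_pdivrMr ?ltr_wpDl// mul1r lerDl//.
apply/le_anti; rewrite le1/=.
have [->|a0] := eqVneq a 0; first by rewrite normr0 mul0r linf_c0_norm_ge0.
rewrite -{1}[x]scale1r -(mulVf a0) -scalerA.
by rewrite -ler_pdivlMl ?normr_gt0// -normfV le1.
Qed.

Lemma linf_c0_normr0_eq0 x : linf_c0_norm x = 0 -> x = 0.
Proof.
have [f <-] := cl_surj x => f0; rewrite -cl0; apply/cl_eq/c0P => e e0.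
have [g gf ge] : exists2 g, cl g = cl f & `|g| < e / 2.
  by apply: linf_c0_norm_lt; rewrite f0 divr_gt0.
move/esym/cl_eq/c0P : gf => /(_ (e / 2)); rewrite divr_gt0// => /(_ isT).
apply: sub_finite_set => i /=; rewrite subr0 => fi.
rewrite -(lerD2r (e / 2)) -splitr (le_trans fi)//.
rewrite -[f i](subrK (g i)) (le_trans (ler_normD _ _))// lerD2l.
by rewrite (le_trans (linf_norm_ub g i))// ltW.
Qed.

HB.instance Definition _ := Lmodule_isNormed.Build R linf_c0
  linf_c0_ler_normD linf_c0_normrZ linf_c0_normr0_eq0.

End bounded_functions.

Arguments linf_pred : clear implicits.
Arguments c0 : clear implicits.

Lemma c0_natP (R : realType) (f : linf R nat) :
  f \in c0 R nat <-> (f : nat -> R) @ \oo --> (0 : R).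
Proof.
split=> [/c0P fc|f0].
  apply/cvgr0Pnorm_lt => e e0.
  have /finite_seqP[F FE] := fc _ e0.
  exists (\sum_(i <- F) i.+1)%N => // n /= Fn.
  rewrite ltNge; apply/negP => fn.
  have nF : [set` F] n by rewrite -FE.
  by move: Fn; rewrite (big_rem n)//= leqNgt ltnS leq_addr.
apply/c0P => e e0; have /cvgr0Pnorm_lt /(_ _ e0) [N _ fN] := f0.
apply: sub_finite_set (finite_II N) => n /=; rewrite leNgt => fn.
by rewrite /= ltnNge; apply: contra fn => /fN.
Qed.

Section blocks.
Context (R : realType).

Section extension_restriction.
Context (I : Type) (S : set I).

Fact ext0_subproof (g : linf R S) : 'valL_0 (g : S -> R) \in linf_pred R I.
Proof.
have [M gM] := linf_predP _ (linf_valP g); apply/linf_predP; exists `|M| => i.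
rewrite /valL_/= oinv_set_val; case: insubP => [j _ _|_]/=.
  exact: le_trans (gM j) (ler_norm _).
by rewrite normr0.
Qed.

Definition ext0 (g : linf R S) : linf R I := Linf (ext0_subproof g).

Lemma ext0_in (g : linf R S) (j : S) : ext0 g (set_val j) = g j.
Proof. by have := congr1 (fun h : S -> R => h j) (valLK 0 (g : S -> R)). Qed.

Lemma ext0_out (g : linf R S) i : ~ S i -> ext0 g i = 0.
Proof.
by move=> Si; rewrite /= /valL_/= oinv_set_val insubN//; apply/negP => /set_mem.
Qed.

Fact restr_subproof (f : linf R I) : sigL S f \in linf_pred R S.
Proof.
have [M fM] := linf_predP _ (linf_valP f).
by apply/linf_predP; exists M => i; exact: fM.
Qed.

Definition restr (f : linf R I) : linf R S := Linf (restr_subproof f).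

Definition inclusion (x : linf_c0 R S) : linf_c0 R I := cl (ext0 (repr x)).

Definition projection (x : linf_c0 R I) : linf_c0 R S := cl (restr (repr x)).

Lemma inclusionE (g : linf R S) : inclusion (cl g) = cl (ext0 g).
Proof.
apply/cl_eq/c0P => e e0.
have /cl_eq/c0P/(_ e e0) : cl (repr (cl g)) = cl g by exact: reprK.
move=> /(finite_image set_val); apply: sub_finite_set => i /=.
have [Si|Si] := pselect (S i).
  have E h : ext0 h i = h (SigSub (mem_set Si)).
    exact: (ext0_in h (SigSub (mem_set Si))).
  rewrite -[X in _ <= X -> _]/(`|ext0 (repr (cl g)) i - ext0 g i|) !E => ei.
  by exists (SigSub (mem_set Si)).
rewrite -[X in _ <= X -> _]/(`|ext0 (repr (cl g)) i - ext0 g i|).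
by rewrite !ext0_out// subrr normr0 leNgt e0.
Qed.

Lemma projectionE (f : linf R I) : projection (cl f) = cl (restr f).
Proof.
apply/cl_eq/c0P => e e0.
have /cl_eq/c0P/(_ e e0) : cl (repr (cl f)) = cl f by exact: reprK.
move=> /(finite_preimage (f := set_val)); apply.
by move=> i j _ _; exact: val_inj.
Qed.

Lemma inclusionK : cancel inclusion projection.
Proof.
move=> x; have [g <-] := cl_surj x; rewrite inclusionE projectionE.
by congr cl; apply/val_inj/funext => j; exact: ext0_in.
Qed.

Lemma projectionK : finite_set (~` S) -> cancel projection inclusion.
Proof.
move=> finS x; have [f <-] := cl_surj x; rewrite projectionE inclusionE.
apply/cl_eq/c0P => e e0; apply: sub_finite_set finS => i.
rewrite /= -[X in _ <= X -> _]/(`|ext0 (restr f) i - f i|) => ei Si.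
move: ei; have -> : ext0 (restr f) i = f i.
  exact: (ext0_in (restr f) (SigSub (mem_set Si))).
by rewrite subrr normr0 leNgt e0.
Qed.

End extension_restriction.

Definition block (T : linf_c0 R nat -> linf_c0 R nat) (B A : set nat) :
    linf_c0 R A -> linf_c0 R B :=
  @projection nat B \o T \o @inclusion nat A.

Definition liftable (T : linf_c0 R nat -> linf_c0 R nat) : Prop :=
  exists L : {linear linf R nat -> linf R nat},
    [/\ bounded_near L (nbhs 0),
        {in c0 R nat, forall f, L f \in c0 R nat} &
        forall f, T (cl f) = cl (L f)].

(* [g] is the product of the matrix [b] with the column [f]; the sum over [A']
   is taken in the order of nat, the summand being 0 outside of [A']. *)
Definition matrix_image (A B : set nat) (A' : set A) (B' : set B)
    (b : B' -> A' -> R) (f : linf R A') (g : linf R B') : Prop :=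
  forall i : B',
    series ('valL_0 ('valL_0 (fun j : A' => b i j * f j))) @ \oo --> g i.

Definition bounded_c0_matrix (A B : set nat) (A' : set A) (B' : set B)
    (b : B' -> A' -> R) : Prop :=
  exists C : R, forall f : linf R A', f \in c0 R A' ->
    exists g : linf R B',
      [/\ g \in c0 R B', matrix_image b f g & `|g| <= C * `|f|].

(* The spaces for A' and A are identified by [inclusion], those for B and B' by
   [projection]; see [inclusionK] and [projectionK]. *)
Definition matrix_operator (A B : set nat) (U : linf_c0 R A -> linf_c0 R B) :
    Prop :=
  exists (A' : set A) (B' : set B) (b : B' -> A' -> R),
    [/\ finite_set (~` A'), finite_set (~` B'), bounded_c0_matrix b &
        forall f : linf R A', exists2 g : linf R B', matrix_image b f g &
          projection B' (U (inclusion (cl f))) = cl g].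

End blocks.

Arguments block {R} T B A _.

(* Main.v *)
Require Import Defs.
From HB Require Import structures.
From mathcomp Require Import all_boot all_order all_algebra.
From mathcomp Require Import all_classical all_reals all_analysis.

Import Order.TTheory GRing.Theory Num.Theory.
Import numFieldNormedType.Exports.

Local Open Scope classical_set_scope.
Local Open Scope ring_scope.

(** Choose nonprincipal ultrafilters q_n concentrated on the sets of a partition
    of nat into infinitely many pieces, and let L map a bounded f to the
    sequence of its limits along the q_n. This is a linear contraction, and it
    kills null sequences since the q_n are nonprincipal; it therefore induces an
    operator T on the quotient, lifted by L. It is onto since f can be
    prescribed to be constant on each piece of the partition.

    As L kills the null sequences, its coefficients L(1_{j}) all vanish, and the
    point is that no other matrix can represent a block of T either, not even up
    to null sequences. In the block from A to B, only the i in B such that A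
    belongs to q_i contribute; if they are finitely many, the block is zero. If
    they are infinitely many and the block is given by a matrix, then for these
    i and every set E, the sum over E of the i-th row of the matrix is
    asymptotically 1 or 0 according to whether E is in q_i or not. A gliding
    hump argument ([ultralimits_not_matrix]) excludes this: infinitely many rows
    have most of their mass on disjoint finite intervals, and by Rosenthal's
    disjointification trick ([escaping_subfamily]) the union of infinitely many
    of these intervals is null for the ultrafilters of the corresponding rows;
    removing it ruins the rows of the matrix but not the ultralimits. *)

(** * Ultrafilters against a disjoint family of finite sets *)

Lemma infinite_range (T : Type) (f : nat -> T) :
  injective f -> infinite_set (range f).
Proof.
move=> f_inj; suff /eq_finite_set -> : (range f #= [set: nat])%card.
  exact: infinite_nat.
by apply: (@inj_card_eq _ _ setT) => i j _ _ /f_inj.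
Qed.

Lemma infinite_unbounded (K : set nat) (N : nat) :
  infinite_set K -> exists2 k, K k & (N <= k)%N.
Proof.
move=> infK; apply: contrapT => K_lt; apply: infK.
apply: sub_finite_set (finite_II N) => k Kk /=.
by rewrite ltnNge; apply/negP => Nk; apply: K_lt; exists k.
Qed.

Lemma finite_set_eventually_out (S : set nat) :
  finite_set S -> \forall n \near \oo, ~ S n.
Proof.
move=> /finite_seqP[s ->]; exists (\max_(j <- s) j).+1 => // n /= lt_n ns.
by have := @leq_bigmax_seq _ s xpredT id n ns isT; rewrite leqNgt lt_n.
Qed.

Lemma ultra_setC (T : Type) (q : set_system T) (E : set T) :
  UltraFilter q -> q (~` E) <-> ~ q E.
Proof.
move=> uq; split=> [qEC qE|nqE].
  apply: (@filter_not_empty _ q).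
  by apply: filterS (filterI qE qEC) => x [].
by have [] := in_ultra_setVsetC E uq.
Qed.

(** A case of Rosenthal's disjointification lemma. Split the indices into
    infinitely many infinite classes, and let U_m be the union of the F k over
    the m-th class. If some U_m is missed by all the ultrafilters of its own
    class, that class will do. Otherwise each class m has an index k_m whose
    ultrafilter charges U_m; as the U_m are disjoint and nonprincipal
    ultrafilters ignore the finite set F k_m, that ultrafilter misses the union
    of all the F k_m, and the k_m form the required set. *)
Lemma escaping_subfamily (q : nat -> set_system nat) (F : nat -> set nat) :
  (forall k, UltraFilter (q k)) -> (forall k, \oo `<=` q k) ->
  (forall k, finite_set (F k)) -> trivIset setT F ->
  exists2 K : set nat, infinite_set K &
    forall k, K k -> q k (~` \bigcup_(l in K) F l).
Proof.
move=> uq q_oo finF disF.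
pose code (m r : nat) : nat := pickle (m, r).
have code_inj m r m' r' : code m r = code m' r' -> m = m' /\ r = r'.
  by move=> /(pcan_inj pickleK)[].
have [[m good]|bad] :=
  pselect (exists m, forall r, q (code m r) (~` \bigcup_r' F (code m r'))).
  exists (range (code m)); first by apply: infinite_range => r r' /code_inj[].
  move=> _ [r _ <-]; apply: filterS (good r).
  by apply: subsetC => x [_ [r' _ <-]]; exists r'.
have {}bad m : exists r, q (code m r) (\bigcup_r' F (code m r')).
  apply: contrapT => /forallNP badm; apply: bad; exists m => r.
  by apply/ultra_setC; exact: badm.
have [r rP] := choice bad.
exists (range (fun m => code m (r m))).
  by apply: infinite_range => m m' /code_inj[].
move=> _ [m _ <-].
have qF : q (code m (r m)) (~` F (code m (r m))).
  by apply/q_oo/finite_set_eventually_out/finF.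
apply: filterS (filterI (rP m) qF) => x [[r' _ xr'] xm] [_ [m' _ <-]] xm'.
have [mm'|mm'] := eqVneq m m'; first by rewrite -mm' in xm'.
have /code_inj[/eqP] : code m r' = code m' (r m').
  by apply: disF => //; exists x.
by rewrite (negbTE mm').
Qed.

(** * A sequence of ultralimits is not asymptotically a matrix *)

Lemma abs_summable (R : realType) (a : R ^nat) :
  (forall E : set nat, cvgn (series (fun j => a j * \1_E j))) ->
  cvgn (series (fun j => `|a j|)).
Proof.
move=> cvg_a; pose P := [set j | 0 <= a j].
rewrite (_ : (fun _ => _) =
    (fun j => a j * \1_P j) - (fun j => a j * \1_(~` P) j)).
  by apply: is_cvg_seriesB; exact: cvg_a.
apply/funext => j.
rewrite -[RHS]/(a j * \1_P j - a j * \1_(~` P) j) !indicE.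
have [aj|aj] := lerP 0 (a j).
  have PCj : ~ (~` P) j by apply.
  by rewrite (mem_set (A := P) aj) (memNset PCj) mulr1 mulr0 subr0 ger0_norm.
have nPj : ~ P j by move=> /(lt_le_trans aj); rewrite ltxx.
by rewrite (memNset nPj) (mem_set (A := ~` P) nPj) mulr0 mulr1 sub0r ltr0_norm.
Qed.

(** If the mass of a lies mostly in [N, M[, then sums of a over sets that avoid
    this hump are small. *)
Lemma sum_off_hump (R : realType) (a : R ^nat) (E : set nat) (N M m : nat)
    (d e : R) :
  (N <= M)%N ->
  (forall j, (N <= j < M)%N -> ~ E j) ->
  \sum_(0 <= j < N) `|a j| <= d ->
  (forall m, \sum_(M <= j < m) `|a j| <= e) ->
  `|series (fun j => a j * \1_E j) m| <= d + e.
Proof.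
move=> NM E0 ad ae; pose b j := `|a j * \1_E j|.
have ba j : b j <= `|a j|.
  rewrite /b normrM indicE.
  by case: (_ \in _); rewrite ?normr1 ?normr0 ?mulr1 ?mulr0.
have Mm := leq_maxr m M.
apply: (le_trans (ler_norm_sum _ _ _)).
apply: (@le_trans _ _ (\sum_(0 <= j < maxn m M) b j)).
  rewrite (@big_cat_nat _ _ _ m 0 (maxn m M))//= ?leq_maxl// lerDl.
  by apply: sumr_ge0 => j _; exact: normr_ge0.
rewrite (@big_cat_nat _ _ _ M 0 (maxn m M))//=.
rewrite (@big_cat_nat _ _ _ N 0 M)//=.
rewrite (_ : \sum_(N <= j < M) b j = 0) ?addr0; last first.
  rewrite big_nat big1// => j NjM.
  by rewrite /b indicE memNset ?mulr0 ?normr0//; exact: E0.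
apply: lerD; [apply: le_trans ad|apply: le_trans (ae (maxn m M))];
  by apply: ler_sum => j _; exact: ba.
Qed.

(** A gliding hump argument. Finite sets are null for all the ultrafilters, so
    the columns of c are null, whereas its rows are absolutely summable; hence
    there are rows n_0, n_1, ... whose masses lie, up to 1/2, on consecutive
    finite intervals F_0, F_1, .... For an infinite set K of indices k, the
    ultrafilter of row n_k contains the complement E of the union of the F_l,
    l in K: its ultralimit of the indicator of E is 1, while row n_k, having
    lost its hump, gives E a mass of at most 1/2. *)
Lemma ultralimits_not_matrix (R : realType) (q : nat -> set_system nat)
    (c : nat -> R ^nat) (mu : nat -> set nat -> R) :
  (forall n, UltraFilter (q n)) -> (forall n, \oo `<=` q n) ->
  (forall n E, series (fun j => c n j * \1_E j) @ \oo --> mu n E) ->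
  ~ (forall E, (fun n => `[< q n E >]%:R - mu n E) @ \oo --> (0 : R)).
Proof.
move=> uq q_oo c_mu mu_q.
(* The columns of [c] are null: test the convergence on singletons. *)
have c0 j : c n j @[n --> \oo] --> (0 : R).
  have mu1 n : mu n [set j] = c n j.
    apply: (cvg_unique _ (c_mu n [set j])) => //.
    apply: cvg_near_cst; exists j.+1 => // m /= jm.
    rewrite /series/= (@big_cat_nat _ _ _ j.+1 0 m)//= big_nat_recr//=.
    rewrite !big_nat !big1 ?add0r ?addr0 ?indicE ?mem_set ?mulr1//.
      move=> i /andP[ji _]; rewrite indicE memNset ?mulr0//= => ij.
      by rewrite ij ltnn in ji.
    move=> i /andP[_ ij]; rewrite indicE memNset ?mulr0//= => eij.
    by rewrite eij ltnn in ij.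
  have qN n : ~ q n [set j].
    apply/ultra_setC/q_oo.
    by exists j.+1 => // m /= jm mj; rewrite mj ltnn in jm.
  rewrite -oppr0 (_ : c^~ j = (fun n =>
      - (`[< q n [set j] >]%:R - mu n [set j]))); first exact: cvgN.
  by apply/funext => n; rewrite mu1 asboolF// sub0r opprK.
have c_head N : \forall n \near \oo, \sum_(0 <= j < N) `|c n j| <= 4^-1.
  suff : \sum_(0 <= j < N) `|c n j| @[n --> \oo] --> (0 : R).
    by move=> /cvgr_le; apply; rewrite invr_gt0.
  rewrite [X in _ --> X](_ : 0 = \sum_(0 <= j < N) `|0 : R|); last first.
    by rewrite big1// => j _; rewrite normr0.
  apply: (@cvg_big _ _ +%R 0 xpredT add_continuous) => j _.
  exact: cvg_norm.
have c_tail n : \forall M \near \oo,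
    forall m, \sum_(M <= j < m) `|c n j| <= 4^-1.
  have /cvg_cauchy/cauchy_seriesP/(_ 4^-1) :
      cvgn (series (fun j => `|c n j|)).
    by apply: abs_summable => E; apply: cvgP; exact: c_mu.
  rewrite invr_gt0 ltr0n => /(_ isT)[[A B] [[N _ NA] [N' _ NB]] AB].
  exists (maxn N N') => // M /= NM m.
  have [Mm|mM] := leqP M m; last by rewrite big_geq// ltnW.
  apply: le_trans (ler_norm _) _; apply/ltW/(AB (M, m)); split => /=.
    by apply: NA => /=; exact: leq_trans (leq_maxl _ _) NM.
  by apply: NB => /=; exact: leq_trans (leq_trans (leq_maxr _ _) NM) Mm.
have hump N : exists nM : nat * nat, [/\ (N <= nM.1)%N, (N < nM.2)%N,
    \sum_(0 <= j < N) `|c nM.1 j| <= 4^-1 &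
    forall m, \sum_(nM.2 <= j < m) `|c nM.1 j| <= 4^-1].
  have [n [Nn hn]] := filter_ex (filterI (nbhs_infty_ge N) (c_head N)).
  have [M [NM hM]] := filter_ex (filterI (nbhs_infty_gt N) (c_tail n)).
  by exists (n, M); split.
have [step stepP] := choice hump.
(* [s k] is the left end of the k-th hump, which lies in row [row k]. *)
pose s k := iter k (fun N => (step N).2) 0%N.
pose row k := (step (s k)).1.
have s_lt k : (s k < s k.+1)%N by have [] := stepP (s k).
have s_homo : {homo s : k l / (k <= l)%N}.
  by apply: homo_leq => // [k|k]; [exact: leq_trans|exact: ltnW].
have s_ge k : (k <= s k)%N.
  by elim: k => // k IH; exact: leq_ltn_trans IH (s_lt k).
pose F k := [set j | (s k <= j < s k.+1)%N].
have [K infK qK] : exists2 K : set nat, infinite_set K &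
    forall k, K k -> q (row k) (~` \bigcup_(l in K) F l).
  apply: (@escaping_subfamily (q \o row) F) => [k|k|].
  - exact: q_oo.
  - by apply: sub_finite_set (finite_II (s k.+1)) => j /= /andP[].
  - apply: ltn_trivIset => l k kl; apply/seteqP; split => // j [].
    move=> /= /andP[_ jsk] /andP[slj _].
    by have := leq_ltn_trans (leq_trans (s_homo _ _ kl) slj) jsk; rewrite ltnn.
set E := ~` _ in qK.
have := mu_q E; move=> /cvgr0Pnorm_lt/(_ 2^-1); rewrite invr_gt0 ltr0n.
move=> /(_ isT)[N0 _ small].
have [k Kk N0k] := infinite_unbounded _ N0 infK.
have [Nn _ head tail] := stepP (s k).
have /small : (N0 <= row k)%N.
  exact: leq_trans N0k (leq_trans (s_ge k) Nn).
rewrite /= asboolT; last exact: qK.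
suff mu_le : `|mu (row k) E| <= 2^-1.
  rewrite ltNge => /negP; apply; rewrite -(lerD2r `|mu (row k) E|).
  apply: (@le_trans _ _ (1 : R)).
    by rewrite [leRHS]splitr mul1r lerD2l.
  by rewrite -[X in X <= _]normr1 -{1}[1](subrK (mu (row k) E)) ler_normD.
apply: (cvgr_to_le (cvg_norm (c_mu (row k) E))); apply: nearW => m.
rewrite (_ : 2^-1 = 4^-1 + 4^-1); last first.
  by rewrite [LHS]splitr -invfM -natrM.
apply: (@sum_off_hump _ _ _ (s k) (s k.+1)) => //; first exact/ltnW.
by move=> j Fkj; rewrite /E => /= nF; apply: nF; exists k.
Qed.

(** * The operator of ultralimits *)

(** Through nat = nat * nat, the n-th ultrafilter refines the image on the row
    {n} * nat of the filter of cofinite sets. *)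
Lemma disjoint_ultrafilters :
  exists (row : nat -> nat) (q : nat -> set_system nat),
    [/\ forall n, UltraFilter (q n), forall n, \oo `<=` q n &
        forall n, q n [set j | row j = n]].
Proof.
pose row j := (odflt (0, 0)%N (unpickle j)).1.
pose cell (n k : nat) : nat := pickle (n, k).
have proper n : ProperFilter (cell n @ \oo).
  exact: fmap_proper_filter.
have [q qP] := choice (fun n => ultraFilterLemma (proper n)).
exists row, q; split=> n; have [uq sub] := qP n => //.
  move=> E [N _ NE]; apply: sub.
  suff : \forall k \near \oo, E (cell n k) by [].
  have : finite_set (cell n @^-1` [set j | (j < N)%N]).
    by apply: finite_preimage (finite_II N) => k l _ _ /(pcan_inj pickleK)[].
  move=> /finite_set_eventually_out; apply: filterS => k /= /negP.
  by rewrite -leqNgt => /NE.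
apply: sub; suff : \forall k \near \oo, row (cell n k) = n by [].
by apply: nearW => k; rewrite /row pickleK.
Qed.

(** Compactness provides a cluster point, to which an ultrafilter converges. *)
Lemma cvg_ultrafilter (R : realType) (T : Type) (q : set_system T) (f : T -> R)
    (M : R) :
  UltraFilter q -> (forall x, `|f x| <= M) -> cvg (f @ q).
Proof.
move=> uq fM.
have [l [_ fl]] : `[- M, M] `&` cluster (f @ q) !=set0.
  apply: segment_compact; apply: (@filterS _ q _ setT); last exact: filterT.
  by move=> x _ /=; rewrite in_itv/= -ler_norml.
apply: (cvgP l) => U Ul; have [//|nU] := in_ultra_setVsetC (f @^-1` U) uq.
by have [y []] := fl (~` U) U nU Ul.
Qed.

Lemma ultralimit_operator (R : realType) (I J : Type) (q : I -> set_system J) :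
  (forall i, UltraFilter (q i)) ->
  exists L : {linear linf R J -> linf R I},
    (forall (f : linf R J) i, f @ q i --> L f i) /\ forall f, `|L f| <= `|f|.
Proof.
move=> uq.
have cvgq (f : linf R J) i : f @ q i --> lim (f @ q i).
  exact: cvg_ultrafilter (linf_norm_ub f).
have limq (f : linf R J) i : `|lim (f @ q i)| <= `|f|.
  apply: (cvgr_to_le (cvg_norm (cvgq f i))); apply: nearW => x.
  exact: linf_norm_ub.
have bnd (f : linf R J) : (fun i => lim (f @ q i)) \in linf_pred R I.
  by apply/linf_predP; exists `|f| => i; exact: limq.
pose L f := Linf (bnd f).
have Llin : linear L.
  move=> a f g; apply/val_inj/funext => i; apply/cvg_lim => //.
  by apply: cvgD; [apply: cvgM (cvgq f i); exact: cvg_cst|exact: cvgq].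
pose linL := GRing.isLinear.Build _ _ _ _ L Llin.
pose L' : {linear linf R J -> linf R I} := HB.pack L linL.
exists L'; split; first exact: cvgq.
by move=> f; apply: linf_norm_le => // i; exact: limq.
Qed.

Lemma quotient_operator (R : realType) (I J : Type)
    (L : {linear linf R J -> linf R I}) (C : R) :
  (forall f, `|L f| <= C * `|f|) ->
  {in c0 R J, forall f, L f \in c0 R I} ->
  exists T : {linear linf_c0 R J -> linf_c0 R I},
    bounded_near T (nbhs 0) /\ forall f, T (cl f) = cl (L f).
Proof.
move=> LC Lc0; pose T (x : linf_c0 R J) := cl (L (repr x)).
have TE f : T (cl f) = cl (L f).
  apply/cl_eq; rewrite -linearB; apply: Lc0; apply/cl_eq; exact: reprK.
have Tlin : linear T.
  move=> a x y; have [f <-] := cl_surj x; have [g <-] := cl_surj y.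
  have -> : a *: cl f + cl g = cl (a *: f + g) by rewrite linearP.
  by rewrite !TE !linearP.
pose linT := GRing.isLinear.Build _ _ _ _ T Tlin.
pose T' : {linear linf_c0 R J -> linf_c0 R I} := HB.pack T linT.
exists T'; split=> //.
exists `|C|; split=> [|M CM]; first exact: num_real.
have : \forall x \near (0 : linf_c0 R J), `|x| < 1.
  exact: nbhs0_lt.
apply: filterS => x /linf_c0_norm_lt[f <- f1].
suff : `|T (cl f)| <= M by []; rewrite TE.
apply: (le_trans (linf_c0_norm_le _)); apply: (le_trans (LC f)).
apply: le_trans (ltW CM); apply: (le_trans (ler_norm _)).
by rewrite normrM normr_id ler_piMr// ltW.
Qed.

(** * Blocks that are matrix operators *)

Lemma valL0_in (R : realType) (I : Type) (S : set I) (u : S -> R) (i : S) :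
  'valL_0 u (set_val i) = u i.
Proof. by have := congr1 (fun h : S -> R => h i) (valLK 0 u). Qed.

Lemma valL0_out (R : realType) (I : Type) (S : set I) (u : S -> R) i :
  ~ S i -> 'valL_0 u i = 0.
Proof.
move=> Si; rewrite /valL_/= oinv_set_val insubN//.
by apply/negP => /set_mem.
Qed.

Section nested_subsets.
Context {A : set nat} (A' : set A).

(** The indices of the matrix live in a subset of a subset of nat; [point]
    reads them back in nat, where the gliding hump argument takes place. *)
Definition point (a : A') : nat := set_val (set_val a).

Lemma valL0_point (R : realType) (u : A' -> R) a :
  'valL_0 ('valL_0 u) (point a) = u a.
Proof. by rewrite /point !valL0_in. Qed.

Lemma valL0_pointN (R : realType) (u : A' -> R) j :
  ~ range point j -> 'valL_0 ('valL_0 u) j = 0.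
Proof.
move=> nj; have [Aj|] := pselect (A j); last exact: valL0_out.
pose a : A := SigSub (mem_set Aj).
rewrite [LHS](valL0_in _ _ _ ('valL_0 u) a) valL0_out// => A'a.
by apply: nj; exists (SigSub (mem_set A'a)).
Qed.

Lemma finite_setD_point :
  finite_set (~` A') -> finite_set (A `\` range point).
Proof.
move=> /(finite_image set_val); apply: sub_finite_set => j [Aj nj].
exists (SigSub (mem_set Aj)) => //= A'a.
by apply: nj; exists (SigSub (mem_set A'a)).
Qed.

End nested_subsets.

(** The function needs to be the indicator of E on a set of the ultrafilter
    only: extending by zero outside of such a set does not affect the limit. *)
Lemma ultralimit_indic (R : realType) (T : Type) (q : set_system T)
    (E A : set T) (f : T -> R) (l : R) :
  UltraFilter q -> q A -> {in A, f =1 \1_E} -> f @ q --> l ->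
  l = `[< q E >]%:R.
Proof.
move=> uq qA fE fl; apply: (cvg_unique _ fl) => //; apply: cvg_near_cst.
have [qE|nqE] := pselect (q E).
  apply: filterS (filterI qA qE) => x [Ax Ex].
  by rewrite fE ?inE// indicE mem_set// asboolT.
have qEC : q (~` E) by apply/ultra_setC.
apply: filterS (filterI qA qEC) => x [Ax Ex].
by rewrite fE ?inE// indicE memNset// asboolF.
Qed.

(** If this set were infinite, the rows of the matrix indexed by a sequence in
    it would compute, up to a null sequence, the ultralimits of the indicator of
    every set, contrary to [ultralimits_not_matrix]. *)
Lemma matrix_block_finite (R : realType) (q : nat -> set_system nat)
    (L : linf R nat -> linf R nat) (T : linf_c0 R nat -> linf_c0 R nat)
    (A B : set nat) :
  (forall n, UltraFilter (q n)) -> (forall n, \oo `<=` q n) ->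
  (forall (f : linf R nat) i, f @ q i --> L f i) ->
  (forall f, T (cl f) = cl (L f)) ->
  matrix_operator (block T B A) -> finite_set [set i | B i /\ q i A].
Proof.
move=> uq q_oo limL TL [A' [B' [b [finA' finB' _ bT]]]].
apply: contrapT => infD.
(* All but finitely many points of [B] index rows of the matrix, so the sequence
   can be taken among the latter. *)
have /infiniteP/pcard_leP[row] :=
  infinite_setD infD (finite_setD_point B' finB').
have rowP k : B (row k) /\ q (row k) A /\ exists b', point B' b' = row k.
  have [[Bk qk] nBk] := @funS _ _ _ _ row k I; split=> //; split=> //.
  apply: contrapT => nk; apply: nBk; split=> // -[b' _ b'k].
  by apply: nk; exists b'.
have [s sP] := choice (fun k => (rowP k).2.2).
have s_inj : injective s.
  move=> k l /(congr1 (point B')); rewrite !sP.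
  by apply: (@inj _ _ setT row); rewrite inE.
(* The columns missing in [A'] are finitely many, hence negligible. *)
have qA' k : q (row k) (range (point A')).
  have qA := (rowP k).2.1.
  have qd : q (row k) (~` (A `\` range (point A'))).
    exact/q_oo/finite_set_eventually_out/finite_setD_point.
  apply: filterS (filterI qA qd) => j [Aj nAj].
  by apply: contrapT => nj; apply: nAj.
pose ind (E : set nat) : A' -> R := fun a => \1_E (point _ a).
have ind_bnd E : ind E \in linf_pred R A'.
  apply/linf_predP; exists 1 => a; rewrite /ind indicE.
  by case: (_ \in _); rewrite ?normr1 ?normr0.
pose f E : linf R A' := Linf (ind_bnd E).
have /choice[g gP] E : exists g : linf R B', matrix_image b (f E) g /\
    projection B' (block T B A (inclusion (cl (f E)))) = cl g.
  by have [g] := bT (f E); exists g.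
pose c k : R ^nat := 'valL_0 ('valL_0 (b (s k))).
apply: (@ultralimits_not_matrix R (q \o row) c (fun k E => g E (s k))).
- by move=> k; exact: q_oo.
- move=> k E; have [/(_ (s k)) + _] := gP E.
  set u := 'valL_0 _; rewrite (_ : u = fun j => c k j * \1_E j)//.
  apply/funext => j; rewrite /u /c.
  have [[a _ <-]|nj] := pselect (range (point A') j).
    by rewrite !valL0_point.
  by rewrite !valL0_pointN// mul0r.
- move=> E; have [_] := gP E.
  rewrite /block/= !(inclusionE, TL, projectionE) => /cl_eq/c0P small.
  apply/cvgr0Pnorm_lt => e /small.
  move=> /(finite_preimage (in2W s_inj))/finite_set_eventually_out.
  have LE k : L (ext0 (ext0 (f E))) (row k) = `[< q (row k) E >]%:R.
    apply: (@ultralimit_indic _ _ _ _ _ _ _ (uq _) (qA' k) _ (limL _ _)) => j.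
    by rewrite inE => -[a _ <-]; exact: valL0_point.
  by apply: filterS => k /negP; rewrite -ltNge/= -LE -sP.
Qed.

Theorem proposition4p12 (R : realType) :
  exists T : {linear linf_c0 R nat -> linf_c0 R nat},
    [/\ bounded_near T (nbhs 0),
        (forall y, exists x, T x = y),
        liftable T &
        forall A B : set nat, infinite_set A -> infinite_set B ->
          matrix_operator (block T B A) ->
          forall x : linf_c0 R A, block T B A x = 0].
Proof.
have [row [q [uq q_oo qrow]]] := disjoint_ultrafilters.
have [L [limL L_le]] := ultralimit_operator R _ _ q uq.
have L0 f : f \in c0 R nat -> L f = 0.
  move=> /c0_natP f0; apply/val_inj/funext => i.
  apply: (cvg_unique _ (limL f i)) => //.
  by apply: cvg_trans f0; apply: cvg_app; exact: q_oo.
have [T [T_bnd TL]] : exists T : {linear linf_c0 R nat -> linf_c0 R nat},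
    bounded_near T (nbhs 0) /\ forall f, T (cl f) = cl (L f).
  apply: (@quotient_operator _ _ _ L 1) => f; first by rewrite mul1r.
  by move=> /L0 ->; exact: rpred0.
exists T; split=> //.
- move=> y; have [g <-] := cl_surj y.
  (* [g] is the image of the function that is constantly [g n] on row n. *)
  have g_row : (fun j => g (row j)) \in linf_pred R nat.
    by apply/linf_predP; exists `|g| => j; exact: linf_norm_ub.
  exists (cl (Linf g_row)); rewrite TL; congr cl; apply/val_inj/funext => i.
  apply: (cvg_unique _ (limL (Linf g_row) i)) => //.
  by apply: cvg_near_cst; apply: filterS (qrow i) => j /= ->.
- exists L; split=> //; last by move=> f /L0 ->; exact: rpred0.
  exists 1; split=> // M M1; have := nbhs0_lt (V := linf R nat) (@ltr01 R).
  apply: filterS => f f1; apply: (le_trans (L_le f)).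
  exact: ltW (lt_trans f1 M1).
- move=> A B _ _ /(matrix_block_finite _ _ _ _ _ _ uq q_oo limL TL) finD x.
  (* Outside of a finite set of [i] in [B], the ultrafilter [q i] misses [A], so
     the limit along [q i] of a function supported by [A] is 0. *)
  have [f <-] := cl_surj x.
  rewrite /block/= inclusionE TL projectionE -cl0; apply/cl_eq/c0P => e e0.
  have := @finite_preimage _ _ _ (set_val : B -> nat) _ finD.
  move=> /(_ (in2W val_inj)); apply: sub_finite_set => i /=; rewrite subr0.
  move=> e_le; split; first exact: set_valP.
  apply: contrapT => nqA.
  have qAC : q (set_val i) (~` A) by apply/ultra_setC.
  have Li : L (ext0 f) (set_val i) = 0.
    apply: (cvg_unique _ (limL _ _)) => //; apply: cvg_near_cst.
    by apply: filterS qAC => j; exact: ext0_out.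
  move: e_le; rewrite -[X in _ <= X]/(`|L (ext0 f) (set_val i)|) Li normr0.
  by rewrite leNgt e0.
Qed.
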